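(* The Wilton function $W=W_1$ is not a $\mathrm{BMO}$ function (i.e. does not belong to $\mathrm{BMO}(\mathbb{R})$).
   Context: Gauss map: $G(0)=0$ and $G(x)=\{1/x\}=\frac1x-\lfloor\frac1x\rfloor$ for $x\in(0,1)$. Put $\beta_{-1}(x)=1$, $\beta_j(x)=\prod_{i=0}^jG^i(x)$ for $j\ge0$. The Wilton function is, for (almost every) irrational $x\in(0,1)$, $$W(x)=\sum_{n=0}^\infty(-1)^n\beta_{n-1}(x)\log\left(\frac1{G^n(x)}\right),$$ extended to $\mathbb{R}$ as a $\mathbb{Z}$-periodic function. For an interval $U$ a locally integrable $f$ is in $\mathrm{BMO}(U)$ if $\sup_{I\subset U}\frac1{|I|}\int_I|f(x)-f_I|\,dx<\infty$, where the supremum is over bounded intervals $I$ and $f_I=\frac1{|I|}\int_If(x)\,dx$. *)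

(* Defs.v *)
From HB Require Import structures.
From mathcomp Require Import all_boot all_order all_algebra.
From mathcomp Require Import all_classical all_reals all_analysis.

Set Implicit Arguments.
Unset Strict Implicit.
Unset Printing Implicit Defensive.
Import Order.TTheory GRing.Theory Num.Theory.
Import numFieldNormedType.Exports.

Local Open Scope classical_set_scope.
Local Open Scope ring_scope.

Section Wilton.
Context {R : realType}.
Implicit Types x : R.

Definition gauss x : R :=
  if x == 0 then 0 else x^-1 - (Num.floor x^-1)%:~R.

(* The index is shifted by one: [gauss_beta n x] is beta_{n-1}(x), so that
   [gauss_beta 0 x = 1] is beta_{-1}(x). *)
Definition gauss_beta (n : nat) x : R := \prod_(i < n) iter i gauss x.

Definition wilton_term x (n : nat) : R :=
  (-1) ^+ n * gauss_beta n x * ln (iter n gauss x)^-1.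

(* The series converges for almost every x in (0, 1). On the remaining null
   set (which includes the rationals, where the orbit reaches 0 and the
   conventions 0^-1 = 0 and ln 0 = 0 apply) the value is immaterial. *)
Definition wilton01 x : R := limn (series (wilton_term x)).

Definition wilton x : R := wilton01 (x - (Num.floor x)%:~R).

End Wilton.

Section BMO.
Context {R : realType}.
Let mu := @lebesgue_measure R.

Definition mean (f : R -> R) (I : set R) : R :=
  (fine (mu I))^-1 * Rintegral mu I f.

(* [iavg g I] is the mean over I of the absolute value of g. *)
Definition mean_oscillation (f : R -> R) (I : set R) : \bar R :=
  iavg (fun x => f x - mean f I) I.

(* U is meant to be an interval. Local integrability is integrability on the
   compact subsets of U; the predicate [locally_integrable] also requires U to
   be open, which would rule out intervals containing an endpoint. *)
Definition BMO (U : set R) (f : R -> R) : Prop :=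
  (forall K : set R,
     compact K -> K `<=` U -> mu.-integrable K (EFin \o f)) /\
  (ereal_sup [set mean_oscillation f I | I in
     [set I : set R |
       [/\ is_interval I, bounded_set I, I `<=` U & 0 < mu I]]] < +oo)%E.

End BMO.

(* Main.v *)
Require Import Defs.
From mathcomp Require Import all_boot all_order all_algebra.
From mathcomp Require Import all_classical all_reals all_analysis.
From mathcomp Require Import measurable_realfun ring lra.

(** Near the origin [wilton] behaves like log (1 / |x|) on the right and like
    - log (1 / |x|) on the left, up to bounded errors on a fixed proportion of
    each side; such an odd logarithmic singularity has unbounded mean
    oscillation. Both behaviours come from the functional equation
    W(x) = log (1 / x) - x W(G(x)), lemma [wilton01_gauss]. On the right of 0
    the logarithm is the first term. On the left, x + 1 = 1 / (1 + y) with a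
    small y > 0, so G(x + 1) = y and W(x) = log (1 + y) - W(y) / (1 + y), which
    is about - log (1 / y).

    Controlling the remainder requires the convergence of the series. This is
    done pointwise, for y whose iterates G^(n+1)(y) exceed (3 / 4)^n / 48
    (predicate [slow_orbit]). The products beta_n decay like (5 / 7)^n because
    z G(z) <= 1 / 2, hence the n-th term of the series, n >= 1, is dominated by a
    geometric sequence of ratio (5 / 7) (4 / 3) = 20 / 21, and
    W(y) >= log (1 / y) - 1008 ([wilton01_slow_orbit]). This one bound serves both
    sides of 0, since W(x) is a decreasing function of W(y) on the left.

    Slow orbits are frequent at every scale. Take a set D mapped by f into
    (0, 1 / m), such that the preimage of an interval in D has at most the measure
    of this interval. The measure of the part of D where
    G(f(x)) lies in [a, b] is at most 2 / (m - 1) times the Gauss measure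
    log ((1 + b) / (1 + a)) ([measure_gauss_start]), and G preserves such a bound
    since it preserves the Gauss measure ([measure_gauss_step], a telescoping
    sum). A union bound over n then leaves slow orbits on a set of measure at
    least 1 / (2 (m + 1)) ([slow_orbit_set]). It applies to f(x) = x on the right
    of 0 and to f(x) = 1 / (1 + x) - 1 on the left.

    Finally, on I = (- 1 / (m + 1), 1 / m), whatever the mean of W is, W is at
    distance at least (log m - 1010) / 2 from it on a set occupying at least one
    eighth of I: on the right if the mean is nonpositive, on the left otherwise.
    So the mean oscillation on I tends to infinity with m. *)

Import Order.TTheory GRing.Theory Num.Theory numFieldNormedType.Exports.

Local Open Scope classical_set_scope.
Local Open Scope ring_scope.

(** * The Gauss map *)

Lemma gauss_itv (R : realType) (x : R) : 0 <= gauss x < 1.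
Proof.
rewrite /gauss; case: ifP => _; first by rewrite lexx ltr01.
have := floor_itv x^-1; rewrite intrD => /andP[h1 h2].
by rewrite subr_ge0 h1 /= ltrBlDl.
Qed.

Lemma iter_gauss_itv (R : realType) (n : nat) (x : R) :
  0 <= x < 1 -> 0 <= iter n gauss x < 1.
Proof. by case: n => [//|n] _; exact: gauss_itv. Qed.

(** The branches of the Gauss map: [k] is the first continued fraction digit,
    and points close to 0 only see large digits. *)
Lemma gauss_digit (R : realType) (x : R) (m : nat) :
  0 < x -> x < m%:R^-1 -> exists2 k : nat, (m <= k)%N & x^-1 = k%:R + gauss x.
Proof.
move=> x0 xm; have m0 : 0 < m%:R :> R.
  by rewrite -invr_gt0 (lt_trans x0 xm).
have mx : m%:R < x^-1 by rewrite -[m%:R]invrK ltf_pV2 ?posrE ?invr_gt0.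
have mf : (m%:Z <= Num.floor x^-1)%R.
  by rewrite floor_ge_int -[X in X <= _]pmulrn ltW.
exists `|Num.floor x^-1|%N.
  by rewrite -lez_nat gez0_abs// (le_trans _ mf).
have -> : (`|Num.floor x^-1|%N)%:R = (Num.floor x^-1)%:~R :> R.
  by rewrite pmulrn gez0_abs// (le_trans _ mf).
by rewrite /gauss gt_eqF//; ring.
Qed.

Lemma measurable_invr (R : realType) : measurable_fun [set: R] (@GRing.inv R).
Proof.
have -> : @GRing.inv R = fun x => if x == 0 then 0 else x^-1.
  by apply/funext => x; case: eqP => // ->; rewrite invr0.
apply: measurable_fun_if => //; first exact: measurable_fun_eqr.
rewrite setTI.
have -> : (fun x : R => x == 0) @^-1` [set false] = ~` [set (0 : R)].
  by apply/seteqP; split=> x /=; [move=> /negbT/eqP|move/eqP/negbTE].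
apply: open_continuous_measurable_fun.
  by rewrite openC; exact: closed_eq.
by move=> x; rewrite inE => /eqP /inv_continuous.
Qed.

Lemma measurable_gauss (R : realType) : measurable_fun [set: R] (@gauss R).
Proof.
have -> : @gauss R = fun x => x^-1 - (Num.floor x^-1)%:~R.
  by apply/funext => x; rewrite /gauss; case: eqP => // ->; rewrite invr0 floor0 subrr.
have mf : measurable_fun [set: R] (fun y : R => (Num.floor y)%:~R : R).
  by apply: nondecreasing_measurable => // x y xy; rewrite ler_int le_floor.
apply: measurable_funB; first exact: measurable_invr.
exact: measurableT_comp mf (measurable_invr R).
Qed.

Lemma measurable_iter_gauss (R : realType) (n : nat) :
  measurable_fun [set: R] (iter n (@gauss R)).
Proof.
elim: n => [|n IH]; first exact: measurable_id.
rewrite (_ : iter _ _ = gauss \o iter n gauss)//.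
by apply: measurableT_comp => //; exact: measurable_gauss.
Qed.

(** * The Wilton series along a slow orbit *)

(** Writing k for the integer part of 1 / x, x k + x G(x) = 1, and
    x k >= x >= x G(x). *)
Lemma mul_gauss_le (R : realType) (x : R) : 0 <= x < 1 -> x * gauss x <= 2^-1.
Proof.
rewrite le_eqVlt => /andP[/predU1P[<-|x0] x1]; first by rewrite mul0r; lra.
have x1' : x < 1%:R^-1 by rewrite invr1.
have [k k1 kE] := gauss_digit _ _ _ x0 x1'.
have /andP[_ g1] := gauss_itv _ x.
have k1R : 1 <= k%:R :> R by rewrite ler1n.
have : x * (k%:R + gauss x) = 1 by rewrite -kE divff// gt_eqF.
by nra.
Qed.

Lemma gauss_betaS (R : realType) (n : nat) (x : R) :
  gauss_beta n.+1 x = gauss_beta n x * iter n gauss x.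
Proof. by rewrite /gauss_beta big_ord_recr. Qed.

Lemma gauss_betaSl (R : realType) (n : nat) (x : R) :
  gauss_beta n.+1 x = x * gauss_beta n (gauss x).
Proof.
rewrite /gauss_beta big_ord_recl; congr (_ * _).
by apply: eq_bigr => i _; rewrite -iterSr.
Qed.

(** Two steps of the orbit gain a factor 1 / 2, which is at most (5 / 7)^2; the
    rational rate 5 / 7 replaces the optimal square root of 1 / 2. *)
Lemma gauss_beta_bound (R : realType) (n : nat) (x : R) : 0 <= x < 1 ->
  0 <= gauss_beta n x <= 7 / 5 * (5 / 7) ^+ n.
Proof.
move=> x01.
have b0 k : 0 <= gauss_beta k x.
  by apply: prodr_ge0 => i _; have /andP[] := iter_gauss_itv _ i _ x01.
rewrite b0/=.
(* The recursion has step two, hence the pair of consecutive bounds. *)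
suff : gauss_beta n x <= 7 / 5 * (5 / 7) ^+ n /\
       gauss_beta n.+1 x <= 7 / 5 * (5 / 7) ^+ n.+1 by case.
elim: n => [|n [IH1 IH2]].
  by rewrite gauss_betaS /gauss_beta big_ord0 expr0 expr1/=; lra.
split=> //; rewrite !gauss_betaS -mulrA.
have /mul_gauss_le q := iter_gauss_itv _ n _ x01.
apply: (@le_trans _ _ (7 / 5 * (5 / 7) ^+ n * 2^-1)).
  apply: ler_pM => //.
  have /andP[z0 _] := iter_gauss_itv _ n _ x01.
  by have /andP[w0 _] := gauss_itv _ (iter n gauss x); exact: mulr_ge0.
rewrite !exprS; have : 0 <= (5 / 7 : R) ^+ n by apply: exprn_ge0; lra.
by move=> ?; lra.
Qed.

Lemma wilton_termS (R : realType) (n : nat) (x : R) :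
  wilton_term x n.+1 = - x * wilton_term (gauss x) n.
Proof. by rewrite /wilton_term gauss_betaSl iterSr exprS; ring. Qed.

Lemma wilton_term0 (R : realType) (x : R) : wilton_term x 0 = ln x^-1.
Proof. by rewrite /wilton_term /gauss_beta big_ord0 expr0 !mul1r. Qed.

(** Convergence at [gauss x] is needed, as otherwise both limits are default
    values. *)
Lemma wilton01_gauss (R : realType) (x : R) :
  cvgn (series (wilton_term (gauss x))) ->
  wilton01 x = ln x^-1 - x * wilton01 (gauss x).
Proof.
move=> cv; apply: cvg_lim => //; rewrite -cvg_shiftS /=.
have -> : (fun n => series (wilton_term x) n.+1) =
    (fun n => ln x^-1 - x * series (wilton_term (gauss x)) n).
  apply/funext => n; rewrite /series/= big_nat_recl// wilton_term0; congr (_ + _).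
  by rewrite -mulNr mulr_sumr; apply: eq_bigr => i _; exact: wilton_termS.
by apply: cvgB; [exact: cvg_cst | apply: cvgMl_tmp].
Qed.

(** The rate 3 / 4 is chosen above 5 / 7, so that the bound 1 / G^(n+1)(y) on the
    logarithm still yields summable terms, and below 1, so that the exceptional
    sets have summable measures; 1 / 48 makes these measures small enough in
    [slow_orbit_set]. *)
Definition slow_orbit {R : realType} (y : R) : Prop :=
  forall n, 48^-1 * (3 / 4) ^+ n < iter n.+1 gauss y.

Lemma wilton_term_bound (R : realType) (y : R) (n : nat) : 0 <= y < 1 ->
  48^-1 * (3 / 4) ^+ n < iter n.+1 gauss y ->
  `|wilton_term y n.+1| <= 48 * (20 / 21) ^+ n.
Proof.
move=> y01; set z := iter n.+1 gauss y => lz.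
have t0 : 0 < 48^-1 * (3 / 4) ^+ n :> R by rewrite mulr_gt0// ?exprn_gt0; lra.
have z0 : 0 < z by exact: lt_trans lz.
have /andP[_ z1] : 0 <= z < 1 by exact: gauss_itv.
have /andP[b0 b1] := gauss_beta_bound _ n.+1 _ y01.
rewrite /wilton_term -/z !normrM normrX normrN1 expr1n mul1r (ger0_norm b0).
have zi : 1 <= z^-1 by rewrite invf_ge1// ltW.
rewrite ger0_norm ?ln_ge0//.
have lnz : ln z^-1 <= 48 * (4 / 3) ^+ n.
  apply: (@le_trans _ _ z^-1); first by apply/ltW/ln_sublinear; rewrite invr_gt0.
  have -> : 48 * (4 / 3) ^+ n = (48^-1 * (3 / 4) ^+ n)^-1 :> R.
    by rewrite invfM invrK -exprVn invf_div.
  by rewrite lef_pV2 ?posrE// ltW.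
apply: (le_trans (ler_pM b0 _ b1 lnz)); first by rewrite ln_ge0.
rewrite exprS (_ : 20 / 21 = (5 / 7) * (4 / 3) :> R); last by field.
rewrite (exprMn n (5 / 7)) le_eqVlt; apply/orP; left; apply/eqP.
by move: (_ ^+ n) (_ ^+ n) => p q; field.
Qed.

(** The constant is the sum of the geometric bounds of [wilton_term_bound]:
    48 / (1 - 20 / 21) = 1008. *)
Lemma wilton01_slow_orbit (R : realType) (y : R) : 0 <= y < 1 ->
  slow_orbit y ->
  cvgn (series (wilton_term y)) /\ ln y^-1 - 1008 <= wilton01 y.
Proof.
move=> y01 good.
pose v n : R := if n is k.+1 then 48 * (20 / 21) ^+ k else `|ln y^-1|.
have tv n : `|wilton_term y n| <= v n.
  case: n => [|n]; first by rewrite wilton_term0.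
  exact: wilton_term_bound.
have S n : series (geometric 48 (20 / 21)) n <= 1008 :> R.
  have -> : 1008 = 48 * (1 - 20 / 21)^-1 :> R by field.
  by apply: geometric_le_lim; rewrite ?ger0_norm; lra.
have vS : (fun n => series v n.+1) = (fun n => `|ln y^-1| + series (geometric 48 (20 / 21)) n).
  by apply/funext => n; rewrite /series/= big_nat_recl.
have cv : cvgn (series v).
  apply/cvg_ex; exists (`|ln y^-1| + limn (series (geometric 48 (20 / 21)) : R^nat)).
  rewrite -cvg_shiftS /= vS; apply: cvgD; first exact: cvg_cst.
  by apply: is_cvg_geometric_series; rewrite ger0_norm; lra.
have cw : cvgn (series (wilton_term y)).
  apply: normed_cvg; apply: series_le_cvg cv => //.
    by move=> n; exact: normr_ge0.
  by move=> n; exact: le_trans (normr_ge0 _) (tv n).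
split=> //; apply: limr_ge => //; exists 1%N => // -[//|n] _.
rewrite /series/= big_nat_recl// wilton_term0 lerD2l lerNl -sumrN.
apply: le_trans (S n); apply: ler_sum => i _ /=.
by apply: le_trans (wilton_term_bound _ _ _ y01 (good i)); rewrite ler_normr lexx orbT.
Qed.

(** * The measure of slow orbits *)

(** G^-1 [a, b] is covered by the intervals [1 / (k + b), 1 / (k + a)], one for
    each digit k, together with the point 0 where the digit is undefined; digits
    below [m] do not occur if [f < 1 / m]. The lemma reduces an estimate for
    [gauss \o f] to estimates for [f] on each branch. *)
Lemma measure_gauss_preimage (R : realType) (D : set R) (f : R -> R) (m : nat)
    (a b B : R) (g : nat -> R) :
  measurable D -> measurable_fun [set: R] f ->
  (forall x, D x -> 0 <= f x < m%:R^-1) -> 0 <= a -> (0 < m)%N ->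
  (lebesgue_measure (D `&` f @^-1` [set 0])%R <= 0)%E ->
  (forall k : nat, (m <= k)%N ->
    (lebesgue_measure (D `&` f @^-1` `[(k%:R + b)^-1, (k%:R + a)^-1])%R
      <= (g k)%:E)%E) ->
  (forall n, \sum_(m <= k < n) g k <= B) ->
  (lebesgue_measure (D `&` (gauss \o f) @^-1` `[a, b])%R <= B%:E)%E.
Proof.
move=> mD mf fD a0 m0 Z0 Fg gB.
have mP (Y : set R) : measurable Y -> measurable (D `&` f @^-1` Y).
  by move=> mY; apply: measurableI => //; rewrite -[X in measurable X]setTI; exact: mf.
pose F k := D `&` f @^-1` `[(k%:R + b)^-1, (k%:R + a)^-1].
have mF k : measurable (F k) by apply: mP.
pose U := \bigcup_(k in ~` `I_m) F k.
have mU : measurable U by apply: bigcup_measurable.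
have mZ : measurable (D `&` f @^-1` [set 0]) by apply: mP.
have muU : (lebesgue_measure U <= B%:E)%E.
  apply: (le_trans (measure_sigma_subadditive_tail lebesgue_measure (A := U) (F := F) (N := m) _ _ _)) => //.
  apply: lime_le; first by apply: is_cvg_nneseries.
  apply: nearW => n.
  apply: (@le_trans _ _ (\sum_(m <= k < n) (g k)%:E)%E).
    rewrite big_nat [leRHS]big_nat; apply: lee_sum => k /andP[mk _].
    exact: Fg.
  by rewrite sumEFin lee_fin.
apply: (@le_trans _ _ (lebesgue_measure ((D `&` f @^-1` [set 0]) `|` U)%R)).
  apply: le_measure; rewrite ?inE.
  - apply: measurableI => //; rewrite -[X in measurable X]setTI.
    by apply: measurableT_comp => //; exact: measurable_gauss.
  - exact: measurableU.
  move=> x /= [Dx]; rewrite in_itv/= => /andP[ag gb].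
  have /andP[f0 fm] := fD _ Dx.
  have [fx0|fx0] := eqVneq (f x) 0; first by left.
  have fgt0 : 0 < f x by rewrite lt_def fx0.
  have [k mk kE] := gauss_digit _ _ _ fgt0 fm.
  right; exists k => //=; first by apply/negP; rewrite -leqNgt.
  have k1 : 1 <= k%:R :> R by rewrite ler1n (leq_trans m0).
  split => //=; rewrite in_itv/= -[f x]invrK kE.
  by rewrite !lef_pV2 ?posrE ?lerD2l ?ag ?gb//; lra.
apply: (le_trans (measureU2 _ _ _)) => //.
by rewrite -[leRHS]add0e leeD.
Qed.

(** Invariance of the Gauss measure with density 1 / (1 + x): its values on the
    branches [1 / (k + b), 1 / (k + a)] telescope to its value on [a, b]. Stated for a
    bound by a multiple of this measure, the property iterates along the orbit. *)
Lemma measure_gauss_step (R : realType) (D : set R) (f : R -> R) (c : R) :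
  measurable D -> measurable_fun [set: R] f ->
  (forall x, D x -> 0 <= f x < 1) -> 0 <= c ->
  (forall a b, 0 <= a -> a <= b -> b <= 1 ->
    (lebesgue_measure (D `&` f @^-1` `[a, b])%R
      <= (c * (ln (1 + b) - ln (1 + a)))%:E)%E) ->
  forall a b, 0 <= a -> a <= b -> b <= 1 ->
    (lebesgue_measure (D `&` (gauss \o f) @^-1` `[a, b])%R
      <= (c * (ln (1 + b) - ln (1 + a)))%:E)%E.
Proof.
move=> mD mf fD c0 H a b a0 ab b1.
pose u (k : nat) : R := c * (ln (k%:R + a) - ln (k%:R + b)).
apply: (@measure_gauss_preimage _ _ _ 1 _ _ _ (fun k => u k.+1 - u k)) => //.
- by rewrite invr1.
- by rewrite -set_itv1; apply: (le_trans (H 0 0 _ _ _)) => //; rewrite subrr mulr0.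
- move=> k k1; have k1R : 1 <= k%:R :> R by rewrite ler1n.
  have ka : 0 < k%:R + a by lra.
  have kb : 0 < k%:R + b by lra.
  apply: (le_trans (H _ _ _ _ _)).
  + by rewrite invr_ge0 ltW.
  + by rewrite lef_pV2// lerD2l.
  + by rewrite invf_le1//; lra.
  rewrite lee_fin /u -mulrBr ler_wpM2l//.
  have E (t : R) : 0 < k%:R + t -> ln (1 + (k%:R + t)^-1) = ln (k.+1%:R + t) - ln (k%:R + t).
    move=> t0; rewrite -ln_div ?posrE//; last by rewrite -natr1; lra.
    by congr ln; rewrite -natr1; field; rewrite gt_eqF.
  by rewrite !E//; lra.
- move=> [|n]; first by rewrite big_geq// mulr_ge0// subr_ge0 ler_ln ?posrE; lra.
  rewrite (telescope_sumr u)// /u -mulrBr ler_wpM2l//.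
  have : ln (n.+1%:R + a) <= ln (n.+1%:R + b).
    have : 0 < n.+1%:R :> R by [].
    by move=> ?; rewrite ler_ln ?posrE; lra.
  by rewrite !mulr1n; lra.
Qed.

(** Restricting to digits k >= m gains a factor of order 1 / m: the k-th branch
    has length at most (b - a) / k^2 <= (b - a) (1 / (k - 1) - 1 / k), which sums to
    (b - a) / (m - 1), and b - a is at most twice the integral of 1 / (1 + x)
    over [a, b]. *)
Lemma measure_gauss_start (R : realType) (D : set R) (f : R -> R) (m : nat) :
  measurable D -> measurable_fun [set: R] f -> (1 < m)%N ->
  (forall x, D x -> 0 < f x < m%:R^-1) ->
  (forall a b, 0 <= a -> a <= b ->
    (lebesgue_measure (D `&` f @^-1` `[a, b])%R <= (b - a)%:E)%E) ->
  forall a b, 0 <= a -> a <= b -> b <= 1 ->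
    (lebesgue_measure (D `&` (gauss \o f) @^-1` `[a, b])%R
      <= (2 * (m%:R - 1)^-1 * (ln (1 + b) - ln (1 + a)))%:E)%E.
Proof.
move=> mD mf m1 fD H a b a0 ab b1.
have m1R : 2 <= m%:R :> R by rewrite ler_nat.
pose u (k : nat) : R := - (b - a) * (k%:R - 1)^-1.
have : b - a <= 2 * (ln (1 + b) - ln (1 + a)).
  have <- : ln ((1 + b) / (1 + a)) = ln (1 + b) - ln (1 + a).
    by rewrite ln_div// posrE; lra.
  have := @le_ln1Dx _ ((1 + a) / (1 + b) - 1).
  (* log u >= 1 - 1 / u with u = (1 + b) / (1 + a) *)
  have -> : 1 + ((1 + a) / (1 + b) - 1) = ((1 + b) / (1 + a))^-1.
    by rewrite invf_div; ring.
  rewrite lnV ?posrE; last by rewrite divr_gt0; lra.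
  have q : (b - a) / 2 <= 1 - (1 + a) / (1 + b).
    rewrite (_ : 1 - _ = (b - a) / (1 + b)); last by field; lra.
    by rewrite ler_wpM2l ?lef_pV2 ?posrE; lra.
  have : -1 < (1 + a) / (1 + b) - 1 by rewrite ltrBrDl subrr divr_gt0; lra.
  by move=> h /(_ h); lra.
move=> le_ab.
apply: (@measure_gauss_preimage _ _ _ m _ _ _ (fun k => u k.+1 - u k)) => //.
- by move=> x /fD /andP[/ltW -> ->].
- by rewrite ltnW.
- rewrite (_ : _ `&` _ = set0) ?measure0//; apply/seteqP; split=> // x [/= /fD].
  by move=> /[swap] ->; rewrite ltxx.
- move=> k mk; have k1R : m%:R <= k%:R :> R by rewrite ler_nat.
  have ka : 0 < k%:R + a by lra.
  have kb : 0 < k%:R + b by lra.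
  apply: (le_trans (H _ _ _ _)).
  + by rewrite invr_ge0 ltW.
  + by rewrite lef_pV2// lerD2l.
  rewrite lee_fin /u -natr1 addrK.
  rewrite [leLHS](_ : _ = (b - a) * ((k%:R + a)^-1 * (k%:R + b)^-1)); last first.
    by field; rewrite !gt_eqF.
  rewrite [leRHS](_ : _ = (b - a) * ((k%:R - 1)^-1 * k%:R^-1)); last first.
    by field; rewrite !gt_eqF//; lra.
  by rewrite ler_wpM2l ?subr_ge0// ler_pM ?invr_ge0 ?lef_pV2 ?posrE; lra.
- have p0 : 0 <= (m%:R - 1)^-1 :> R by rewrite invr_ge0; lra.
  have G : (b - a) * (m%:R - 1)^-1 <= 2 * (m%:R - 1)^-1 * (ln (1 + b) - ln (1 + a)).
    by rewrite mulrAC ler_wpM2r.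
  move=> n; apply: le_trans G; have [nm|mn] := leqP n m.
    by rewrite big_geq// mulr_ge0// subr_ge0.
  have p1 : 0 <= (b - a) * (n%:R - 1)^-1.
    rewrite mulr_ge0 ?subr_ge0// invr_ge0 subr_ge0 ler1n.
    by rewrite (leq_trans _ mn).
  by rewrite (telescope_sumr u) ?(ltnW mn)// /u !mulNr; lra.
Qed.

Lemma measure_iter_gauss_le (R : realType) (D : set R) (f : R -> R) (m n : nat) (t : R) :
  measurable D -> measurable_fun [set: R] f -> (1 < m)%N ->
  (forall x, D x -> 0 < f x < m%:R^-1) ->
  (forall a b, 0 <= a -> a <= b ->
    (lebesgue_measure (D `&` f @^-1` `[a, b])%R <= (b - a)%:E)%E) ->
  0 <= t <= 1 ->
  (lebesgue_measure (D `&` (iter n.+1 gauss \o f) @^-1` `[0, t])%R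
      <= (2 * (m%:R - 1)^-1 * t)%:E)%E.
Proof.
move=> mD mf m1 fD H /andP[t0 t1].
have m1R : 2 <= m%:R :> R by rewrite ler_nat.
have c0 : 0 <= 2 * (m%:R - 1)^-1 :> R by rewrite mulr_ge0// invr_ge0; lra.
have K : forall a b, 0 <= a -> a <= b -> b <= 1 ->
    (lebesgue_measure (D `&` (iter n.+1 gauss \o f) @^-1` `[a, b])%R
      <= (2 * (m%:R - 1)^-1 * (ln (1 + b) - ln (1 + a)))%:E)%E.
  elim: n => [|n IH]; first exact: measure_gauss_start.
  apply: (@measure_gauss_step _ _ (iter n.+1 gauss \o f)) => //.
    by apply: measurableT_comp => //; exact: measurable_iter_gauss.
  by move=> x _; exact: gauss_itv.
apply: (le_trans (K _ _ _ _ _)) => //.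
rewrite lee_fin ler_wpM2l// addr0 ln1 subr0 le_ln1Dx//; lra.
Qed.

(** The exceptional set has measure at most the sum over n of
    2 / (m - 1) (3 / 4)^n / 48, that is 1 / (6 (m - 1)) <= 1 / (2 (m + 1)) since
    m >= 2: at most half of the lower bound assumed on the measure of [D]. *)
Lemma slow_orbit_set (R : realType) (D : set R) (f : R -> R) (m : nat) :
  measurable D -> measurable_fun [set: R] f -> (1 < m)%N ->
  (forall x, D x -> 0 < f x < m%:R^-1) ->
  (forall a b, 0 <= a -> a <= b ->
    (lebesgue_measure (D `&` f @^-1` `[a, b])%R <= (b - a)%:E)%E) ->
  ((m.+1%:R^-1)%:E <= lebesgue_measure D)%E ->
  exists2 A, measurable A & A `<=` D /\
   (((2 * m.+1%:R)^-1)%:E <= lebesgue_measure A)%E /\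
   forall x, A x -> slow_orbit (f x).
Proof.
move=> mD mf m1 fD H Dm.
have m1R : 2 <= m%:R :> R by rewrite ler_nat.
pose t n : R := 48^-1 * (3 / 4) ^+ n.
pose F n := D `&` (iter n.+1 gauss \o f) @^-1` `[0, t n].
have mF n : measurable (F n).
  apply: measurableI => //; rewrite -[X in measurable X]setTI.
  by apply: measurableT_comp => //; exact: measurable_iter_gauss.
pose U := \bigcup_n F n.
have mU : measurable U by apply: bigcup_measurable.
have t0 n : 0 <= t n by rewrite mulr_ge0// exprn_ge0//; lra.
have t1 n : t n <= 1.
  by rewrite mulr_ile1 ?exprn_ge0 ?exprn_ile1//; lra.
have p0 : 0 < (m%:R - 1)^-1 :> R by rewrite invr_gt0; lra.
have muU : (lebesgue_measure U <= ((2 * m.+1%:R)^-1)%:E)%E.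
  apply: (le_trans (measure_sigma_subadditive lebesgue_measure (A := U) (F := F) _ _ _)) => //.
  apply: lime_le; first by apply: is_cvg_nneseries.
  apply: nearW => n.
  apply: (@le_trans _ _ (\sum_(0 <= k < n) (2 * (m%:R - 1)^-1 * t k)%:E)%E).
    by apply: lee_sum => k _; apply: measure_iter_gauss_le => //; rewrite t0 t1.
  rewrite sumEFin lee_fin -mulr_sumr -mulr_sumr.
  have S : \sum_(0 <= k < n) (3 / 4 : R) ^+ k <= 4.
    rewrite [leRHS](_ : _ = 1 * (1 - 3 / 4)^-1); last by field.
    rewrite (eq_bigr (geometric 1 (3 / 4))); last first.
      by move=> i _; rewrite /geometric/= mul1r.
    by apply: geometric_le_lim; rewrite ?ger0_norm; lra.
  have E : 6^-1 * (m%:R - 1)^-1 <= (2 * m.+1%:R)^-1 :> R.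
    by rewrite -invfM lef_pV2 ?posrE -?natr1; nra.
  apply: le_trans E.
  rewrite [leLHS](_ : _ = (m%:R - 1)^-1 *
      (2 / 48 * \sum_(0 <= k < n) (3 / 4) ^+ k)); last by ring.
  by rewrite mulrC ler_wpM2r ?(ltW p0)//; lra.
have UD : U `<=` D by move=> x [n _ []].
exists (D `\` U); first exact: measurableD.
split; first by move=> x [].
split; last first.
  move=> x [Dx nU] n; rewrite ltNge; apply/negP => le_t; apply: nU.
  exists n => //; split=> //=; rewrite in_itv/= le_t andbT.
  by have /andP[] := gauss_itv _ (iter n gauss (f x)).
have DU : (lebesgue_measure D <= lebesgue_measure (D `\` U) + lebesgue_measure U)%E.
  apply: le_trans (measureU2 _ _ _) => //; last exact: measurableD.
  by rewrite setUC setDUK.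
have := le_trans Dm (le_trans DU (leeD2l _ muU)).
rewrite -leeBlDr// -EFinB; apply: le_trans.
rewrite lee_fin invfM; have : 0 < m.+1%:R^-1 :> R by rewrite invr_gt0 ltr0n.
by move: m.+1%:R^-1 => z z0; lra.
Qed.

(** * The two sides of the origin *)

Lemma wilton_ge_right (R : realType) (x : R) : 0 < x < 1 ->
  slow_orbit x ->
  ln x^-1 - 1008 <= wilton x.
Proof.
move=> /andP[x0 x1] good; have x01 : 0 <= x < 1 by rewrite ltW.
rewrite /wilton (@floor_def _ _ 0) ?add0r// subr0.
by have [] := wilton01_slow_orbit _ x x01 good.
Qed.

(** By periodicity the value is taken at 1 + x = 1 / (1 + y), where the functional
    equation reverses the sign of the singularity; its factor 1 / (1 + y) is at
    least 1 / 2. *)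
Lemma wilton_le_left (R : realType) (x : R) : - 2^-1 < x < 0 ->
  slow_orbit ((1 + x)^-1 - 1) ->
  ln ((1 + x)^-1 - 1)^-1 - 1008 >= 0 ->
  wilton x <= 1 - 2^-1 * (ln ((1 + x)^-1 - 1)^-1 - 1008).
Proof.
set y := (1 + x)^-1 - 1 => /andP[x1 x0] good.
have y1 : y < 1.
  by rewrite ltrBlDr -[1 + 1]/(2%:R) invf_plt ?posrE; lra.
have y0 : 0 < y by rewrite subr_gt0 invf_gt1; lra.
have [cv le_y] : cvgn (series (wilton_term y)) /\ ln y^-1 - 1008 <= wilton01 y.
  by apply: wilton01_slow_orbit; rewrite // ?ltW.
rewrite /wilton (@floor_def _ _ (-1)); last by rewrite addNr; lra.
rewrite mulrN1z opprK (addrC x).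
have gE : gauss (1 + x) = y.
  rewrite /gauss gt_eqF; last by lra.
  rewrite (@floor_def _ _ 1)// mulr1z.
  by move: y0 y1; rewrite /y intrD; lra.
rewrite wilton01_gauss gE// => K0.
have : ln (1 + x)^-1 <= y.
  by rewrite (_ : (1 + x)^-1 = 1 + y) ?le_ln1Dx//; [lra | rewrite /y; ring].
by move: (ln _^-1) K0 le_y => L K0 le_y l1; nra.
Qed.

(** Chebyshev's inequality for the deviation from the mean. *)
Lemma mean_oscillation_ge (R : realType) (f : R -> R) (I A : set R) (K : R) :
  measurable I -> (0 < lebesgue_measure I)%E -> (lebesgue_measure I < +oo)%E ->
  measurable_fun I f -> measurable A -> A `<=` I -> 0 <= K ->
  (forall x, A x -> K <= `|f x - mean f I|) ->
  ((lebesgue_measure I)^-1 * (K%:E * lebesgue_measure A) <= mean_oscillation f I)%E.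
Proof.
move=> mI I0 Ioo mf mA AI K0 H.
rewrite /mean_oscillation /iavg; apply: lee_wpmul2l; first by rewrite inve_ge0 ltW.
have mg : measurable_fun I (fun x => (`|(f x - mean f I)%:E|)%E).
  apply: measurableT_comp => //; apply/measurable_EFinP.
  exact: measurable_funB.
apply: (@le_trans _ _ (\int[lebesgue_measure]_(x in A) `|(f x - mean f I)%:E|)%E); last first.
  by apply: ge0_subset_integral.
rewrite -integral_cst//; apply: ge0_le_integral => //.
  exact: measurable_funS mg.
Qed.

Lemma wilton_large_right (R : realType) (m : nat) : (1 < m)%N ->
  exists2 A : set R, measurable A & (A `<=` `]0, m%:R^-1[) /\
   (((2 * m.+1%:R)^-1)%:E <= lebesgue_measure A)%E /\
   forall x, A x -> ln m%:R - 1008 <= wilton x.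
Proof.
move=> m1; have mR : 2 <= m%:R :> R by rewrite ler_nat.
have [||x|a b a0 ab||A mA [AD [Am good]]] :=
  @slow_orbit_set R (`]0, m%:R^-1[) id m _ _ m1 => //.
- apply: (@le_trans _ _ (lebesgue_measure `[a, b]%classic)).
    rewrite preimage_id; apply: le_measure; rewrite ?inE//; exact: measurableI.
  by rewrite lebesgue_measure_itv/= lte_fin; case: ifP => //; rewrite lee_fin subr_ge0.
- have p : 0 < m%:R^-1 :> R by rewrite invr_gt0; lra.
  rewrite lebesgue_measure_itv/= lte_fin p oppr0 adde0 lee_fin lef_pV2 ?posrE -?natr1; lra.
exists A => //; split=> //; split=> // x Ax.
have := AD _ Ax; rewrite /= in_itv/= => /andP[x0 xm].
apply: le_trans (wilton_ge_right _ x _ (good x Ax)).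
  rewrite lerD2r ler_ln ?posrE ?invr_gt0//; last by lra.
  by rewrite -[m%:R]invrK lef_pV2 ?posrE ?ltW ?invr_gt0//; lra.
rewrite x0 (lt_le_trans xm)// invf_le1//; lra.
Qed.

(** The endpoint - 1 / (m + 1) is the one sent to 1 / m by
    x |-> 1 / (1 + x) - 1. The inverse map is a contraction on the nonnegative
    numbers, which gives the measure hypothesis of [slow_orbit_set]. *)
Lemma wilton_small_left (R : realType) (m : nat) : (1 < m)%N -> 0 <= ln m%:R - 1008 :> R ->
  exists2 A : set R, measurable A & (A `<=` `](- m.+1%:R^-1), 0[) /\
   (((2 * m.+1%:R)^-1)%:E <= lebesgue_measure A)%E /\
   forall x, A x -> wilton x <= 1 - 2^-1 * (ln m%:R - 1008).
Proof.
move=> m1 K0; pose c : R := m.+1%:R^-1.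
have mR : 2 <= m%:R :> R by rewrite ler_nat.
have c0 : 0 < c by rewrite invr_gt0 ltr0n.
have c13 : c <= 3^-1 by rewrite lef_pV2 ?posrE -?natr1; lra.
have D1 (x : R) : - c < x -> 0 < 1 + x by lra.
have fE (x : R) : - c < x < 0 -> 0 < (1 + x)^-1 - 1 < m%:R^-1.
  move=> /andP[x1 x0]; rewrite subr_gt0 invf_gt1 ?D1// ltrBlDr.
  apply/andP; split; first lra.
  rewrite (_ : m%:R^-1 + 1 = (1 - c)^-1); last first.
    rewrite /c -natr1; field; rewrite addrK !gt_eqF//; lra.
  by rewrite ltf_pV2 ?posrE; lra.
have mf : measurable_fun [set: R] (fun x => (1 + x)^-1 - 1).
  apply: measurable_funB => //.
  by apply: (measurableT_comp (measurable_invr R)); exact: measurable_funD.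
have [||x|a b a0 ab||A mA [AD [Am good]]] :=
  @slow_orbit_set R (`](- c), 0[) (fun x => (1 + x)^-1 - 1) m _ _ m1 => //.
- exact: fE.
- apply: (@le_trans _ _ (lebesgue_measure `[(1 + b)^-1 - 1, (1 + a)^-1 - 1]%classic)).
    apply: le_measure; rewrite ?inE//.
      by apply: measurableI => //; rewrite -[X in measurable X]setTI; exact: mf.
    move=> x [/= /[!in_itv]/= /andP[x1 x0] /andP[h1 h2]].
    have h := D1 _ x1.
    rewrite lerBlDl lerBrDl -[1 + x in X in _ && X]invrK -[1 + x]invrK.
    by rewrite !lef_pV2 ?posrE ?invr_gt0//; lra.
  rewrite lebesgue_measure_itv/= lte_fin; case: ifP => _; rewrite lee_fin ?subr_ge0//.
  rewrite (_ : _ - _ = (b - a) * ((1 + a)^-1 * (1 + b)^-1)); last first.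
    by field; rewrite !gt_eqF//; lra.
  by rewrite ler_piMr ?subr_ge0// mulr_ile1 ?invr_ge0 ?invf_le1; lra.
- by rewrite lebesgue_measure_itv/= lte_fin oppr_lt0 c0 -EFinB sub0r opprK.
exists A => //; split=> //; split=> // x Ax.
have xD := AD _ Ax; have /andP[y0 ym] := fE _ xD.
move: xD; rewrite /= in_itv/= => /andP[x1 x0].
have l : ln m%:R <= ln ((1 + x)^-1 - 1)^-1 :> R.
  rewrite ler_ln ?posrE ?invr_gt0//; last by lra.
  by rewrite -[m%:R]invrK lef_pV2 ?posrE ?ltW ?invr_gt0//; lra.
apply: le_trans (wilton_le_left _ x _ (good x Ax) _) _; lra.
Qed.

(** One of the two sides is always far from the mean, according to the sign of
    the mean. The factor 1 / 8 bounds from below the proportion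
    (1 / (2 (m + 1))) / (1 / m + 1 / (m + 1)) = m / (2 (2 m + 1)). *)
Lemma wilton_oscillation (R : realType) (m : nat) :
  let I := [set` `](- m.+1%:R^-1), m%:R^-1[] : set R in
  (1 < m)%N -> measurable_fun I (@wilton R) -> 0 <= ln m%:R - 1010 :> R ->
  ((8^-1 * (2^-1 * (ln m%:R - 1010)))%:E <= mean_oscillation (@wilton R) I)%E.
Proof.
move=> I m1 mW K0; pose c : R := m.+1%:R^-1.
have mR : 2 <= m%:R :> R by rewrite ler_nat.
have c0 : 0 < c by rewrite invr_gt0 ltr0n.
have mi0 : 0 < m%:R^-1 :> R by rewrite invr_gt0; lra.
have IE : lebesgue_measure I = (m%:R^-1 + c)%:E.
  by rewrite lebesgue_measure_itv/= -/c lte_fin ifT ?opprK//; lra.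
have [A mA [AI [Am H]]] : exists2 A : set R, measurable A & A `<=` I /\
   (((2 * m.+1%:R)^-1)%:E <= lebesgue_measure A)%E /\
   forall x, A x -> 2^-1 * (ln m%:R - 1010) <= `|wilton x - mean (@wilton R) I|.
  have [le0|ge0] := leP (mean (@wilton R) I) 0.
    have [A mA [AD [Am H]]] := wilton_large_right R m m1.
    exists A => //; split; last split=> //.
      by apply: subset_trans AD _; apply: subset_itvr; rewrite bnd_simp -/c; lra.
    by move=> x /H h; rewrite ger0_norm; lra.
  have [|A mA [AD [Am H]]] := wilton_small_left R m m1; first lra.
  exists A => //; split; last split=> //.
    by apply: subset_trans AD _; apply: subset_itvl; rewrite bnd_simp -/c; lra.
  by move=> x /H h; rewrite ler0_norm; lra.
have I0 : (0 < lebesgue_measure I)%E by rewrite IE lte_fin; lra.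
have Ioo : (lebesgue_measure I < +oo)%E by rewrite IE ltry.
have K1 : 0 <= 2^-1 * (ln m%:R - 1010) :> R by lra.
have mI : measurable I by exact: measurable_itv.
have le_osc := @mean_oscillation_ge R _ I A _ mI I0 Ioo mW mA AI K1 H.
apply: le_trans le_osc.
apply: (@le_trans _ _ ((lebesgue_measure I)^-1 *
  ((2^-1 * (ln m%:R - 1010))%:E * ((2 * m.+1%:R)^-1)%:E))%E); last first.
  apply: lee_wpmul2l; first by rewrite inve_ge0 ltW.
  by apply: lee_wpmul2l.
rewrite IE inver gt_eqF; last by lra.
rewrite -!EFinM lee_fin [leRHS]mulrCA [leLHS]mulrC; apply: ler_wpM2l => //.
rewrite invfM -/c.
rewrite (_ : (m%:R^-1 + c)^-1 * (2^-1 * c) = (2 * (2 + m%:R^-1))^-1); last first.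
  by rewrite /c -natr1; field; rewrite !gt_eqF//; lra.
rewrite lef_pV2 ?posrE; [|lra|lra].
by have : m%:R^-1 <= 1 :> R; [rewrite invf_le1|]; lra.
Qed.

Theorem theorem2p2 (R : realType) : ~ BMO [set: R] (@wilton R).
Proof.
move=> [loc osc].
have [M HM] : exists M : R, forall I : set R, is_interval I -> bounded_set I ->
    (0 < lebesgue_measure I)%E -> (mean_oscillation (@wilton R) I <= M%:E)%E.
  set S := ereal_sup _ in osc.
  have [M SM] : exists M : R, (S <= M%:E)%E.
    case: S osc => [r _|//|_]; first by exists r.
    by exists 0; rewrite leNye.
  exists M => J iJ bJ J0; apply: le_trans SM; apply: ereal_sup_ubound.
  by exists J => //; split.
(* This makes (log m - 1010) / 16 exceed [M]. *)
pose T := expR (16 * `|M| + 1011).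
have [m Tm] : exists m : nat, T < m%:R by exists (Num.truncn T).+1; exact: truncnS_gt.
have T1 : 1 < T by rewrite /T expR_gt1; have := normr_ge0 M; lra.
have m1 : (1 < m)%N by rewrite -(ltr_nat R) (lt_trans T1).
have lm : 16 * `|M| + 1011 <= ln m%:R.
  by rewrite -[leLHS]expRK ler_ln ?posrE ?expR_gt0// ?ltW// ltr0n ltnW.
have mR : 2 <= m%:R :> R by rewrite ler_nat.
have c0 : 0 < m.+1%:R^-1 :> R by rewrite invr_gt0 ltr0n.
have mi0 : 0 < m%:R^-1 :> R by rewrite invr_gt0; lra.
set I := [set` `](- m.+1%:R^-1), m%:R^-1[] : set R.
have I11 : I `<=` `[-1, 1].
  have : m%:R^-1 <= 1 :> R by rewrite invf_le1; lra.
  have : m.+1%:R^-1 <= 1 :> R by rewrite invf_le1 ?ler1n ?ltr0n.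
  by move=> h1 h2; apply: subset_itv; rewrite bnd_simp ?lerN2.
have mW : measurable_fun I (@wilton R).
  have : lebesgue_measure.-integrable `[-1, 1] (EFin \o @wilton R).
    by apply: loc => //; exact: segment_compact.
  move=> /measurable_int /measurable_EFinP; exact: measurable_funS.
have n0 := normr_ge0 M; have n1 := ler_norm M.
have K0 : 0 <= ln m%:R - 1010 :> R by lra.
have HI : (mean_oscillation (@wilton R) I <= M%:E)%E.
  apply: HM; first exact: interval_is_interval.
    exists 1; split=> // B B1 x /I11; rewrite /= in_itv/= => /andP[h1 h2].
    by rewrite ler_norml; lra.
  have cm : - m.+1%:R^-1 < m%:R^-1 :> R by rewrite (lt_trans _ mi0)// oppr_lt0.
  by rewrite lebesgue_measure_itv/= lte_fin cm -EFinB lte_fin subr_gt0.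
have := le_trans (wilton_oscillation R m m1 mW K0) HI.
by rewrite lee_fin; lra.
Qed.
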